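(* Let $(T_1,\lambda_1)$, $(T_2,\lambda_2)$, $(X_1,\mu_1)$, $(X_2,\mu_2)$ be $\sigma$-finite measure spaces and let $p_1,p_2,r_1,r_2\in(0,\infty)$. For $j=1,2$ let $k_j:X_j\times T_j\to[0,\infty)$ be a non-negative $(\mu_j\times\lambda_j)$-measurable function, let $K_j:L^+_{\lambda_j}\to L^+_{\mu_j}$ be the operator $K_jf(x)=\int_{T_j}k_j(x,t)f(t)\,d\lambda_j(t)$, and let $C_j\in[0,\infty]$ be the least constant, finite or infinite, such that \[ \|K_jf\|_{L^{r_j}_{\mu_j}}\le C_j\|f\|_{L^{p_j}_{\lambda_j}}\quad\text{for all } f\in L^+_{\lambda_j}. \] Let $K:L^+_{\lambda_1\times\lambda_2}\to L^+_{\mu_1\times\mu_2}$ be the product operator \[ Kf(x_1,x_2)=\iint_{T_1\times T_2}k_1(x_1,t_1)k_2(x_2,t_2)f(t_1,t_2)\,d(\lambda_1\times\lambda_2)(t_1,t_2). \] Then: (a) If $r_1\ge1$, then for all $f\in L^+_{\lambda_1\times\lambda_2}$, \[ \|Kf\|_{L^{(r_1,r_2)}_{\mu_1\times\mu_2}}\le C_1C_2\,\|f\|_{L^{(p_1,p_2)}_{\lambda_1\times\lambda_2}}. \] (b) If $r_1\ge1$, $r_2\ge1$ and $\min(p_1,r_1)\le\max(p_2,r_2)$, then for all $f\in L^+_{\lambda_1\times\lambda_2}$, \[ \|Kf\|_{L^{(r_1,r_2)}_{\mu_1\times\mu_2}}\le C_1C_2\,\|f\|_{L^{(p_2,p_1)}_{\lambda_2\times\lambda_1}}.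 \]
   Context: For a measure $\lambda$, $L^+_\lambda$ denotes the collection of non-negative $\lambda$-measurable functions (the value $\infty$ is allowed), and $\|f\|_{L^p_\lambda}=\left(\int |f|^p\,d\lambda\right)^{1/p}$ for $0<p<\infty$; this is called a norm even when $p<1$, and it may be infinite. $L^+_{\lambda_1\times\lambda_2}$ is the collection of non-negative $(\lambda_1\times\lambda_2)$-measurable functions on $T_1\times T_2$, and similarly for $L^+_{\mu_1\times\mu_2}$ on $X_1\times X_2$. Mixed norms: for $f\in L^+_{\lambda_1\times\lambda_2}$, \[ \|f\|_{L^{(p_1,p_2)}_{\lambda_1\times\lambda_2}}=\left(\int_{T_2}\left(\int_{T_1}|f(t_1,t_2)|^{p_1}\,d\lambda_1(t_1)\right)^{p_2/p_1}d\lambda_2(t_2)\right)^{1/p_2}, \] \[ \|f\|_{L^{(p_2,p_1)}_{\lambda_2\times\lambda_1}}=\left(\int_{T_1}\left(\int_{T_2}|f(t_1,t_2)|^{p_2}\,d\lambda_2(t_2)\right)^{p_1/p_2}d\lambda_1(t_1)\right)^{1/p_1}. \] The first variable of $f$ is always in the $\lambda_1$ measure space; the order of indices and measures indicates which variable is the inner one. Likewise \[ \|h\|_{L^{(r_1,r_2)}_{\mu_1\times\mu_2}}=\left(\int_{X_2}\left(\int_{X_1}|h(x_1,x_2)|^{r_1}\,d\mu_1(x_1)\right)^{r_2/r_1}d\mu_2(x_2)\right)^{1/r_2}. \] The usual measure-theoretic convention $0\cdot\infty=0$ is used in $[0,\infty]$. *)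

(* Defs.v *)
From HB Require Import structures.
From mathcomp Require Import all_boot all_order all_algebra.
From mathcomp Require Import all_classical all_reals all_analysis.
From mathcomp Require Import measurable_realfun.
Set Implicit Arguments.
Unset Strict Implicit.
Unset Printing Implicit Defensive.
Import Order.TTheory GRing.Theory Num.Theory.
Import numFieldNormedType.Exports.
Local Open Scope classical_set_scope.
Local Open Scope ring_scope.
Local Open Scope ereal_scope.

(* The class L^+: measurability on a product space is with respect to the
   product sigma-algebra. *)
Definition Lplus (d : measure_display) (T : measurableType d) (R : realType)
  : set (T -> \bar R) :=
  [set f : T -> \bar R | measurable_fun [set: T] f /\ forall t, 0 <= f t].

(* The first variable is the inner one. *)
Definition mixed_norm (d1 d2 : measure_display)
  (T1 : measurableType d1) (T2 : measurableType d2) (R : realType)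
  (m1 : {measure set T1 -> \bar R}) (m2 : {measure set T2 -> \bar R})
  (p1 p2 : R) (f : T1 * T2 -> \bar R) : \bar R :=
  (\int[m2]_t2 (\int[m1]_t1 (`|f (t1, t2)| `^ p1)) `^ (p2 / p1)) `^ p2^-1.

Definition kernel_op (dX dT : measure_display)
  (X : measurableType dX) (T : measurableType dT) (R : realType)
  (l : {measure set T -> \bar R}) (k : X * T -> R) (f : T -> \bar R)
  (x : X) : \bar R :=
  \int[l]_t ((k (x, t))%:E * f t).

Definition product_op (dX1 dX2 dT1 dT2 : measure_display)
  (X1 : measurableType dX1) (X2 : measurableType dX2)
  (T1 : measurableType dT1) (T2 : measurableType dT2) (R : realType)
  (l1 : {measure set T1 -> \bar R}) (l2 : {measure set T2 -> \bar R})
  (k1 : X1 * T1 -> R) (k2 : X2 * T2 -> R) (f : T1 * T2 -> \bar R)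
  (x : X1 * X2) : \bar R :=
  \int[l1 \x l2]_t ((k1 (x.1, t.1))%:E * (k2 (x.2, t.2))%:E * f t).

Definition op_bounds (dX dT : measure_display)
  (X : measurableType dX) (T : measurableType dT) (R : realType)
  (l : {measure set T -> \bar R}) (m : {measure set X -> \bar R})
  (p r : R) (k : X * T -> R) : set (\bar R) :=
  [set C | 0 <= C /\ forall f, Lplus f ->
     'N[m]_(r%:E)[kernel_op l k f] <= C * 'N[l]_(p%:E)[f] ].

(* An infimum, attained by [least_op_bound_in] below. *)
Definition least_op_bound (dX dT : measure_display)
  (X : measurableType dX) (T : measurableType dT) (R : realType)
  (l : {measure set T -> \bar R}) (m : {measure set X -> \bar R})
  (p r : R) (k : X * T -> R) : \bar R :=
  ereal_inf (op_bounds l m p r k).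

Section LeastOpBound.
Variables (dX dT : measure_display).
Variables (X : measurableType dX) (T : measurableType dT) (R : realType).
Variables (l : {sigma_finite_measure set T -> \bar R})
  (m : {sigma_finite_measure set X -> \bar R}).
Variables (p r : R) (k : X * T -> R).
Hypotheses (p_gt0 : (0 < p)%R) (r_gt0 : (0 < r)%R)
  (mk : measurable_fun [set: X * T] k) (k_ge0 : forall z, (0 <= k z)%R).
Implicit Types f g : T -> \bar R.

Let mkf f : Lplus f ->
  measurable_fun [set: X * T] (fun z => (k z)%:E * f z.2).
Proof.
move=> [mf _]; apply: emeasurable_funM; first exact/measurable_EFinP.
exact: (measurableT_comp mf measurable_snd).
Qed.

Let kf_ge0 f z : Lplus f -> 0 <= (k z)%:E * f z.2.
Proof. by move=> [_ f0]; rewrite mule_ge0// lee_fin. Qed.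

Let mkx f x : Lplus f ->
  measurable_fun [set: T] (fun t => (k (x, t))%:E * f t).
Proof.
by move=> Lf; exact: (measurableT_comp (mkf Lf) (pair1_measurable x)).
Qed.

Lemma kernel_op_ge0 f x : Lplus f -> 0 <= kernel_op l k f x.
Proof. by move=> Lf; apply: integral_ge0 => t _; exact: (kf_ge0 (x, t) Lf). Qed.

Lemma measurable_kernel_op f : Lplus f ->
  measurable_fun [set: X] (kernel_op l k f).
Proof.
move=> Lf.
apply: (measurable_fun_fubini_tonelli_F (fun z => (k z)%:E * f z.2)).
- exact: mkf.
- by move=> z; exact: kf_ge0.
Qed.

Lemma Lplus_kernel_op f : Lplus f -> Lplus (kernel_op l k f).
Proof.
by move=> Lf; split; [exact: measurable_kernel_op|move=> x; exact: kernel_op_ge0].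
Qed.

Lemma kernel_op_eq0 f x : Lplus f ->
  kernel_op l k f x = 0 <-> (\forall t \ae l, (k (x, t))%:E * f t = 0).
Proof.
move=> Lf; have := ae_eq_integral_abs l measurableT (mkx x Lf).
under eq_integral do rewrite gee0_abs ?(kf_ge0 (x, _) Lf)//.
rewrite -/(kernel_op l k f x) => -[h1 h2]; split.
- by move=> /h1; apply: filterS => t /(_ I).
- by move=> h; apply: h2; apply: filterS h => t + _.
Qed.

Let Lnorm_kernel_op0 f : Lplus f -> 'N[l]_(p%:E)[f] = 0 ->
  'N[m]_(r%:E)[kernel_op l k f] = 0.
Proof.
move=> Lf /(Lnorm_eq0_eq0 (proj1 Lf)); rewrite lte_fin => /(_ p_gt0) f0.
rewrite (@eq_Lnorm _ _ _ _ _ _ (cst 0)) ?Lnorm0 ?eqe ?gt_eqF// => x.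
apply/(kernel_op_eq0 _ Lf); apply: filterS f0 => t /(_ I) /= ->.
by rewrite mule0.
Qed.

Let trunc f (A : set T) t := mine (f t) 1 * (\1_A t)%:E.

Let Lplus_trunc f A : measurable A -> Lplus f -> Lplus (trunc f A).
Proof.
move=> mA [mf f0]; split.
  apply: emeasurable_funM; first exact: measurable_mine.
  by apply/measurable_EFinP; exact: measurable_indic.
by move=> t; rewrite mule_ge0// ?lee_fin// le_min f0/=.
Qed.

Let Lnorm_trunc f A : measurable A -> l A < +oo -> Lplus f ->
  'N[l]_(p%:E)[trunc f A] < +oo.
Proof.
move=> mA lA Lf; rewrite unlock; apply: poweR_lty.
apply: (@le_lt_trans _ _ (\int[l]_t (\1_A t)%:E)); last first.
  by rewrite integral_indic// setIT.
have LA := Lplus_trunc mA Lf.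
apply: ge0_le_integral => //.
- by move=> t _; exact: poweR_ge0.
- apply: (@measurableT_comp _ _ _ _ _ _ (fun x => x `^ p)) => //=.
    exact: (measurableT_comp (measurable_poweR _)).
  by apply: measurableT_comp => //; case: LA.
- by apply/measurable_EFinP; exact: measurable_indic.
move=> t _; rewrite gee0_abs; last by case: LA.
rewrite /trunc indicE; case: (t \in A); last first.
  by rewrite mule0 poweR0r// gt_eqF.
rewrite mule1 -[leRHS](poweR1r p); apply: gt0_ler_poweR; first exact: ltW.
- by rewrite in_itv/= leey andbT le_min (proj2 Lf)/=.
- by rewrite in_itv/= leey andbT.
- by rewrite ge_min lexx orbT.
Qed.

Let Lnorm_kernel_op_all0 :
  (forall g, Lplus g -> 'N[l]_(p%:E)[g] < +oo ->
     'N[m]_(r%:E)[kernel_op l k g] = 0) ->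
  forall f, Lplus f -> 'N[m]_(r%:E)[kernel_op l k f] = 0.
Proof.
move=> H f Lf.
have /sigma_finiteP [F [F_T _ F_oo]] := sigma_finiteT l.
have H0 : \forall x \ae m, forall n, kernel_op l k (trunc f (F n)) x = 0.
  apply: ae_foralln => n; have [mF lF] := F_oo n.
  have LF := Lplus_trunc mF Lf.
  have := H _ LF (Lnorm_trunc mF lF Lf).
  move=> /(Lnorm_eq0_eq0 (measurable_kernel_op LF)).
  by rewrite lte_fin => /(_ r_gt0); apply: filterS => x /(_ I).
have K0 : \forall x \ae m, kernel_op l k f x = 0.
  apply: filterS H0 => x Hx; apply/(kernel_op_eq0 _ Lf).
  have : \forall t \ae l, forall n, (k (x, t))%:E * trunc f (F n) t = 0.
    apply: ae_foralln => n; have [mF _] := F_oo n.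
    exact/(kernel_op_eq0 _ (Lplus_trunc mF Lf)).
  apply: filterS => t Ht.
  have [n _ Fnt] : (\bigcup_n F n) t by rewrite -F_T.
  move: (Ht n); rewrite /trunc indicE mem_set// mule1 => /eqP.
  rewrite mule_eq0 => /orP[/eqP ->|]; first by rewrite mul0e.
  rewrite /mine; case: ifPn => [_ /eqP ->|_]; first by rewrite mule0.
  by rewrite onee_eq0.
rewrite unlock (ae_eq_integral (cst 0))//.
- by rewrite integral0 poweR0r// invr_neq0// gt_eqF.
- apply: (@measurableT_comp _ _ _ _ _ _ (fun x => x `^ r)) => //=.
    exact: (measurableT_comp (measurable_poweR _)).
  by apply: measurableT_comp => //; exact: measurable_kernel_op.
- by apply: filterS K0 => x -> _; rewrite abse0 poweR0r// gt_eqF.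
Qed.

Let least_ge0 : 0 <= least_op_bound l m p r k.
Proof. by apply: le_ereal_inf_tmp => C []. Qed.

Let Lnorm_kernel_op_fin f : Lplus f -> 'N[l]_(p%:E)[f] < +oo ->
  'N[m]_(r%:E)[kernel_op l k f]
    <= least_op_bound l m p r k * 'N[l]_(p%:E)[f].
Proof.
move=> Lf; have [Nf0 _|Nf0] := eqVneq ('N[l]_(p%:E)[f]) 0.
  by rewrite Lnorm_kernel_op0// Nf0 mule0.
have := Lnorm_ge0 l p%:E f.
case Ns : ('N[l]_(p%:E)[f]) => [s| |]// s0 _.
have s_gt0 : (0 < s)%R by rewrite -lte_fin lt_neqAle s0 andbT eq_sym -Ns.
rewrite -lee_pdivrMr//; apply: le_ereal_inf_tmp => C [C0 HC].
by rewrite lee_pdivrMr// -Ns; exact: HC.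
Qed.

Lemma least_op_bound_in : op_bounds l m p r k (least_op_bound l m p r k).
Proof.
split=> // f Lf.
have [Nf|Nf] := ltP ('N[l]_(p%:E)[f]) +oo; first exact: Lnorm_kernel_op_fin.
move: Nf; rewrite leye_eq => /eqP ->.
have [c0|c0] := eqVneq (least_op_bound l m p r k) 0; last first.
  by rewrite gt0_muley ?leey// lt_neqAle eq_sym c0.
rewrite c0 mul0e Lnorm_kernel_op_all0// => g Lg Ng.
apply/eqP; rewrite eq_le Lnorm_ge0 andbT.
by have := Lnorm_kernel_op_fin Lg Ng; rewrite c0 mul0e.
Qed.

End LeastOpBound.

(* Main.v *)
Require Import Defs.
From HB Require Import structures.
From mathcomp Require Import all_boot all_order all_algebra.
From mathcomp Require Import all_classical all_reals all_analysis.
From mathcomp Require Import measurable_realfun.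
Set Implicit Arguments.
Unset Strict Implicit.
Unset Printing Implicit Defensive.
Import Order.TTheory GRing.Theory Num.Theory.
Import numFieldNormedType.Exports.
Local Open Scope classical_set_scope.
Local Open Scope ring_scope.
Local Open Scope ereal_scope.

(** Write [K1], [K2] for the operators acting on the first and on the second
variable, so that [K = K1 K2 = K2 K1]. Two estimates for one factor, say [K1],
carry the proof.
- If the [r1]-norm in [x1] is the inner one, the bound [C1] applies for each
  value of the other variable, with any outer exponent.
- If the inner norm is an [s]-norm in the other variable with [s >= 1],
  Minkowski's integral inequality moves it inside the kernel integral, and the
  bound [C1] then applies to the resulting function of [t1].
Part (a) is the second estimate for [K2] followed by the first one for [K1].
In part (b) one of [p1 <= p2], [r1 <= r2], [p1 <= r2], [r1 <= p2] holds, and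
each allows one to exchange the order of the two norms (again by Minkowski) at
one stage: before both operators, after both, or between them. *)

(** * Norms of functions with values in [[0, oo]] *)

Section Lplus_Lnorm.
Context {d : measure_display} {T : measurableType d} {R : realType}.
Variables (m : {measure set T -> \bar R}) (p : R).
Hypothesis p_gt0 : (0 < p)%R.
Implicit Types f g : T -> \bar R.

Lemma Lplus_poweR f (q : R) : Lplus f -> Lplus (fun t => f t `^ q).
Proof.
move=> [mf _]; split=> [|t]; last exact: poweR_ge0.
exact: (measurableT_comp (measurable_poweR q) mf).
Qed.

Lemma LplusZ (c : \bar R) f : 0 <= c -> Lplus f -> Lplus (fun t => c * f t).
Proof.
by move=> c0 [mf f0]; split=> [|t]; [exact: measurable_funeM|rewrite mule_ge0].
Qed.

Lemma Lnorm_LplusE f : Lplus f ->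
  'N[m]_(p%:E)[f] = (\int[m]_t (f t `^ p)) `^ p^-1.
Proof.
by move=> [_ f0]; rewrite unlock; under eq_integral do rewrite gee0_abs//.
Qed.

Lemma Lnorm_rpow f : p != 0%R -> Lplus f ->
  'N[m]_(p%:E)[f] `^ p = \int[m]_t (f t `^ p).
Proof.
move=> p0 [_ f0]; rewrite poweR_Lnorm//.
by under eq_integral do rewrite gee0_abs//.
Qed.

Lemma integral_Lplus_eq0 f : Lplus f ->
  \int[m]_t f t = 0 <-> \forall t \ae m, f t = 0.
Proof.
move=> [mf f0]; have := ae_eq_integral_abs m measurableT mf.
under eq_integral do rewrite gee0_abs//.
move=> [h1 h2]; split=> [/h1|h]; first by apply: filterS => t; exact.
by apply: h2; apply: filterS h.
Qed.

Lemma le_poweR (x y : \bar R) (r : R) : (0 <= r)%R -> 0 <= x -> x <= y ->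
  x `^ r <= y `^ r.
Proof.
move=> r0 x0 xy; apply: gt0_ler_poweR => //.
- by rewrite in_itv/= x0 leey.
- by rewrite in_itv/= (le_trans x0 xy) leey.
Qed.

Lemma le_integral_Lplus f g : Lplus f -> Lplus g -> (forall t, f t <= g t) ->
  \int[m]_t f t <= \int[m]_t g t.
Proof. by move=> [mf f0] [mg g0] fg; apply: ge0_le_integral. Qed.

Lemma le_Lnorm f g : Lplus f -> Lplus g -> (forall t, f t <= g t) ->
  'N[m]_(p%:E)[f] <= 'N[m]_(p%:E)[g].
Proof.
move=> Lf Lg fg; rewrite !Lnorm_LplusE//; apply: le_poweR => //.
- by rewrite ltW // invr_gt0.
- by apply: integral_ge0 => t _; exact: poweR_ge0.
apply: le_integral_Lplus; [exact: Lplus_poweR..|move=> t].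
by apply: le_poweR => //; [exact: ltW|exact: (proj2 Lf)].
Qed.

(** Powers are multiplicative on [[0, oo]] with [0 * oo = 0], so [c = +oo] is allowed; a least bound
    that may be infinite can thus be pulled out of a norm. *)
Lemma Lnorm_LplusZ (c : \bar R) f : 0 <= c -> Lplus f ->
  'N[m]_(p%:E)[(fun t => c * f t)%E] = c * 'N[m]_(p%:E)[f].
Proof.
move=> c0 Lf; rewrite !Lnorm_LplusE//; last exact: LplusZ.
under eq_integral do rewrite poweRM ?(proj2 Lf)//.
have [mfp fp0] := Lplus_poweR p Lf.
rewrite ge0_integralZl ?poweR_ge0// poweRM ?poweR_ge0 ?integral_ge0//.
by rewrite -poweRrM mulfV ?gt_eqF// poweRe1.
Qed.

End Lplus_Lnorm.

(** * Sections, partial integrals and partial norms on a product space *)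

Section Lplus_prod.
Context {d1 d2 : measure_display} {X : measurableType d1} {Y : measurableType d2}.
Context {R : realType}.
Implicit Types F : X * Y -> \bar R.

Lemma Lplus_swap F : Lplus F -> Lplus (fun z : Y * X => F (z.2, z.1)).
Proof.
move=> [mF F0]; split=> // .
by apply: (measurableT_comp mF); exact: measurable_fun_pair.
Qed.

Lemma Lplus_pair1 F x : Lplus F -> Lplus (fun y => F (x, y)).
Proof.
by move=> [mF F0]; split=> //; exact: (measurableT_comp mF (pair1_measurable x)).
Qed.

Lemma Lplus_pair2 F y : Lplus F -> Lplus (fun x => F (x, y)).
Proof.
by move=> [mF F0]; split=> //; exact: (measurableT_comp mF (pair2_measurable y)).
Qed.

Lemma Lplus_integral2 (m : {sigma_finite_measure set Y -> \bar R}) F :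
  Lplus F -> Lplus (fun x => \int[m]_y F (x, y)).
Proof.
move=> [mF F0]; split=> [|x]; last by apply: integral_ge0.
exact: measurable_fun_fubini_tonelli_F.
Qed.

(** By Tonelli a partial norm is again in [Lplus], so an outer norm or an operator bound can be
    applied to it. *)
Lemma Lplus_Lnorm2 (m : {sigma_finite_measure set Y -> \bar R}) (p : R) F :
  Lplus F -> Lplus (fun x => 'N[m]_(p%:E)[(fun y => F (x, y))]).
Proof.
move=> LF; have := Lplus_poweR p^-1 (Lplus_integral2 m (Lplus_poweR p LF)).
congr Lplus; apply/funext => x.
by rewrite Lnorm_LplusE//; exact: Lplus_pair1.
Qed.

End Lplus_prod.

Lemma Lplus_Lnorm1 {d1 d2 : measure_display} {X : measurableType d1}
  {Y : measurableType d2} {R : realType}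
  (m : {sigma_finite_measure set X -> \bar R}) (p : R) (F : X * Y -> \bar R) :
  Lplus F -> Lplus (fun y => 'N[m]_(p%:E)[(fun x => F (x, y))]).
Proof. by move=> /Lplus_swap LF; exact: (Lplus_Lnorm2 m p LF). Qed.

(** * The inequalities of Hoelder and Minkowski on [[0, oo]] *)

Section Hoelder.
Context {d : measure_display} {T : measurableType d} {R : realType}.
Variable m : {measure set T -> \bar R}.

(** Extends the real-valued inequality to [f] with infinite values. If [g] has norm 0, the left side
    is 0; if [f] has infinite norm and [g] does not have norm 0, the right side is infinite.
    Otherwise [f ^ p] is integrable, hence [f] is finite almost everywhere and [fine \o f] can
    replace it. *)
Lemma hoelder_Lplus (f : T -> \bar R) (g : T -> R) (p q : R) :
  Lplus f -> measurable_fun [set: T] g -> (forall t, 0 <= g t)%R ->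
  (0 < p)%R -> (0 < q)%R -> (p^-1 + q^-1 = 1)%R ->
  \int[m]_t (f t * (g t)%:E) <= 'N[m]_(p%:E)[f] * 'N[m]_(q%:E)[EFin \o g].
Proof.
move=> Lf mg g0 p0 q0 pq; have [mf f0] := Lf.
have mEg : measurable_fun [set: T] (EFin \o g) by exact/measurable_EFinP.
have mfg : measurable_fun [set: T] (fun t => f t * (g t)%:E).
  exact: emeasurable_funM.
have [Ng0|Ng0] := eqVneq 'N[m]_(q%:E)[EFin \o g] 0.
  rewrite (ae_eq_integral (cst 0)) ?integral0 ?mule_ge0 ?Lnorm_ge0//.
  have q0' : (0 < q%:E) by rewrite lte_fin.
  apply: filterS (Lnorm_eq0_eq0 mEg q0' Ng0) => t /= + _ => /(_ I) ->.
  by rewrite mule0.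
have [Nf|Nf] := ltP 'N[m]_(p%:E)[f] +oo; last first.
  move: Nf; rewrite leye_eq => /eqP ->.
  by rewrite gt0_mulye ?leey// lt0e Ng0 Lnorm_ge0.
have f_fin : \forall t \ae m, f t \is a fin_num.
  have ifp : m.-integrable [set: T] (fun t => f t `^ p).
    apply/integrableP; split; first exact: (Lplus_poweR p Lf).1.
    under eq_integral do rewrite gee0_abs ?poweR_ge0//.
    move: Nf; rewrite Lnorm_LplusE//; apply: lty_poweRy.
    by rewrite invr_neq0// gt_eqF.
  apply: filterS (integrable_ae measurableT ifp) => t /(_ I) fin.
  rewrite ge0_fin_numE// (@lty_poweRy _ _ p) ?gt_eqF//.
  by move: fin; rewrite ge0_fin_numE// poweR_ge0.
have mff : measurable_fun [set: T] (fine \o f) by exact: measurableT_comp.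
have := hoelder m mff mg p0 q0 pq; rewrite Lnorm1.
congr (_ <= _ * _).
  apply: ae_eq_integral => //.
    by do 2 apply: measurableT_comp => //; exact: measurable_funM.
  apply: filterS f_fin => t ft _ /=.
  by rewrite ger0_norm ?mulr_ge0 ?fine_ge0// EFinM fineK.
rewrite unlock; congr (_ `^ _).
apply: ae_eq_integral => //.
- apply: (measurableT_comp (measurable_poweR p)).
  by do 3 apply: measurableT_comp => //.
- by apply: (measurableT_comp (measurable_poweR p)); exact: measurableT_comp.
- by apply: filterS f_fin => t ft _; rewrite /comp fineK.
Qed.

End Hoelder.

(* Jensen's inequality with respect to the weight [a y], the norm of [F (., y)],
   which is Hoelder's inequality for [F = (F / g) * g] with [g = a ^ (1 - 1 / r)].
   The points where [a y] vanishes are harmless since [F (., y)] is null there. *)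
Lemma Lnorm_integral_le {d1 d2 : measure_display} {X : measurableType d1}
  {Y : measurableType d2} {R : realType}
  (m : {sigma_finite_measure set X -> \bar R})
  (l : {sigma_finite_measure set Y -> \bar R})
  (r : R) (F : X * Y -> \bar R) :
  (1 <= r)%R -> Lplus F ->
  'N[m]_(r%:E)[(fun x => \int[l]_y F (x, y))] <=
  \int[l]_y 'N[m]_(r%:E)[(fun x => F (x, y))].
Proof.
(* For [r = 1] Tonelli makes both sides equal. *)
rewrite le_eqVlt => /predU1P[<- LF|r1 LF].
  have [mF F0] := LF; rewrite Lnorm1.
  under eq_integral do rewrite gee0_abs ?integral_ge0//.
  rewrite fubini_tonelli//; under [leRHS]eq_integral do rewrite Lnorm1.
  under [leRHS]eq_integral do under eq_integral do rewrite gee0_abs//.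
  exact: lexx.
have r0 : (0 < r)%R by rewrite (lt_trans ltr01).
pose q := (r / (r - 1))%R.
have q0 : (0 < q)%R by rewrite divr_gt0// subr_gt0.
have rq : (r / q = r - 1)%R.
  by rewrite /q invf_div mulrCA mulfV ?mulr1// gt_eqF.
have pq : (r^-1 + q^-1 = 1)%R.
  rewrite /q invf_div -[X in (X + _)%R]mul1r -mulrDl addrC subrK mulfV//.
  by rewrite gt_eqF.
have LH := Lplus_integral2 l LF.
have La := Lplus_Lnorm1 m r LF.
set a := fun y => 'N[m]_(r%:E)[(fun x => F (x, y))] in La *.
have [ma a0] := La; set A := leRHS.
have A0 : 0 <= A by apply: integral_ge0 => y _; exact: a0.
(* Once [A] is finite, [a] is finite almost everywhere, and the real function [b = fine \o a] can
   stand for it. *)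
have [Afin|] := ltP A +oo; last by rewrite leye_eq => /eqP ->; rewrite leey.
have a_fin : \forall y \ae l, a y \is a fin_num.
  have ia : l.-integrable [set: Y] a.
    by apply/integrableP; split=> //; under eq_integral do rewrite gee0_abs//.
  by apply: filterS (integrable_ae measurableT ia) => y; exact.
pose b y := fine (a y).
have b0 y : (0 <= b y)%R by exact: fine_ge0.
have mb : measurable_fun [set: Y] b by exact: measurableT_comp.
pose g y := (b y `^ q^-1)%R.
have g0 y : (0 <= g y)%R by exact: powR_ge0.
have mg : measurable_fun [set: Y] g.
  exact: (measurableT_comp (measurable_powR q^-1) mb).
have mgV : measurable_fun [set: Y] (fun y => (g y)^-1)%R.
  under eq_fun do rewrite -powRN.
  exact: (measurableT_comp (measurable_powR _) mb).
have Lg : Lplus (fun z : X * Y => ((g z.2)^-1)%:E).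
  split=> [|z]; last by rewrite lee_fin invr_ge0.
  apply/measurable_EFinP; exact: (measurableT_comp mgV measurable_snd).
(* Since [fine +oo = 0] and [0^-1 = 0], [F'] vanishes at every [y] where [a y] is 0 or infinite. *)
pose F' (z : X * Y) := F z * ((g z.2)^-1)%:E.
have LF' : Lplus F'.
  split=> [|z]; last by rewrite mule_ge0//; [exact: LF.2|exact: Lg.2].
  by apply: emeasurable_funM; [exact: LF.1|exact: Lg.1].
have LFr := Lplus_poweR r LF'.
(* Off [D] the factor [g] cancels. For almost every [y] in [D], [a y] is finite, hence 0, and
   [F (., y)] is null. So [F0] has double integral 0, and by Tonelli [F (x, .)] vanishes almost
   everywhere on [D] for almost every [x]. *)
have FF' : \forall x \ae m,
    \int[l]_y F (x, y) = \int[l]_y (F' (x, y) * (g y)%:E).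
  pose D := b @^-1` [set 0%R].
  have mD : measurable D by rewrite -[D]setTI; exact: mb.
  pose F0 (z : X * Y) := F z * (\1_D z.2)%:E.
  have LF0 : Lplus F0.
    split=> [|z]; last by rewrite mule_ge0 ?LF.2// lee_fin.
    apply: emeasurable_funM; first exact: LF.1.
    apply/measurable_EFinP.
    exact: (measurableT_comp (measurable_indic mD) measurable_snd).
  have F00 : \int[m]_x \int[l]_y F0 (x, y) = 0.
    rewrite (fubini_tonelli _ LF0.1 LF0.2).
    have LI := Lplus_integral2 m (Lplus_swap LF0).
    apply/(integral_Lplus_eq0 _ LI); apply: filterS a_fin => y ay.
    apply/(integral_Lplus_eq0 _ (Lplus_pair2 y LF0)).
    rewrite /F0 /= indicE; have [|_] := boolP (y \in D); last first.
      by apply: nearW => x; rewrite mule0.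
    rewrite inE => by0; have ay0 : a y = 0.
      by rewrite -(fineK ay); congr EFin.
    have r0' : 0 < r%:E by rewrite lte_fin.
    have := Lnorm_eq0_eq0 (Lplus_pair2 y LF).1 r0' ay0.
    by apply: filterS => x /(_ I) /= ->; rewrite mul0e.
  move/(integral_Lplus_eq0 _ (Lplus_integral2 l LF0)) : F00.
  apply: filterS => x /(integral_Lplus_eq0 _ (Lplus_pair1 x LF0)) F0x.
  apply: ae_eq_integral => //; first exact: (Lplus_pair1 x LF).1.
    apply: emeasurable_funM; first exact: (Lplus_pair1 x LF').1.
    exact/measurable_EFinP.
  apply: filterS F0x => y + _; rewrite /F0 /F' /= indicE.
  have [|yD] := boolP (y \in D).
    by rewrite inE => by0; rewrite mule1 => ->; rewrite !mul0e.
  move=> _; rewrite -muleA -EFinM mulVf ?mule1//.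
  rewrite powR_eq0 negb_and; apply/orP; left.
  by apply: contra yD => /eqP by0; rewrite inE.
(* Where [a y] is finite and positive, the left side is [a ^ r * a ^ (- r / q) = a], because
   [r / q = r - 1]. Where [a y] is infinite, [g y = 0] and the bound is trivial. *)
have F'_le y : \int[m]_x (F' (x, y) `^ r) <= a y.
  have [_ Fy0] := Lplus_pair2 y LF.
  rewrite (eq_integral (fun x => F (x, y) `^ r * (g y)^-1%:E `^ r)); last first.
    by move=> x _; rewrite poweRM ?lee_fin ?invr_ge0.
  have [mFr Fr0] := Lplus_poweR r (Lplus_pair2 y LF).
  rewrite ge0_integralZr ?poweR_ge0//.
  rewrite -Lnorm_rpow ?gt_eqF//; last exact: Lplus_pair2.
  rewrite -/(a y) /g /b; case: (a y) (a0 y) => [s|_|//]; last first.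
    by rewrite powR0 ?invr_neq0 ?gt_eqF// invr0 poweR0r ?gt_eqF// mule0 leey.
  rewrite lee_fin => s0; rewrite !poweR_EFin -EFinM lee_fin/=.
  have [->|sn0] := eqVneq s 0%R; first by rewrite powR0 ?mul0r// gt_eqF.
  rewrite -powRN -powRrM -powRD; last by rewrite sn0 implybT.
  by rewrite mulNr mulrC rq opprB addrCA subrr addr0 powRr1.
have Ng : 'N[l]_(q%:E)[EFin \o g] <= A `^ q^-1.
  have Lg' : Lplus (EFin \o g).
    by split=> [|y]; [exact/measurable_EFinP|rewrite /= lee_fin].
  rewrite Lnorm_LplusE//; apply: le_poweR; first by rewrite ltW// invr_gt0.
    by apply: integral_ge0 => y _; exact: poweR_ge0.
  apply: le_integral_Lplus => //; first exact: Lplus_poweR.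
  move=> y; rewrite /= /g -powRrM mulVf ?gt_eqF// powRr1// /b.
  by rewrite -/(a y); case: (a y) (a0 y) => [s|_|]//; rewrite leey.
rewrite Lnorm_LplusE//.
rewrite [leRHS](_ : A = (A `^ r) `^ r^-1); last first.
  by rewrite -poweRrM mulfV ?poweRe1// gt_eqF.
apply: le_poweR; first by rewrite ltW// invr_gt0.
  by apply: integral_ge0 => x _; exact: poweR_ge0.
(* Hoelder in [y], raised to the power [r], for almost every [x]. By Tonelli and [F'_le] the double
   integral of [F' ^ r] is at most [A], which leaves [A * A ^ (r - 1) = A ^ r]. *)
apply: (@le_trans _ _ (\int[m]_x (\int[l]_y (F' (x, y) `^ r) * A `^ (r / q)))).
  apply: ae_ge0_le_integral => //.
  - by move=> x _; exact: poweR_ge0.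
  - exact: (Lplus_poweR r LH).1.
  - by move=> x _; rewrite mule_ge0 ?poweR_ge0 ?integral_ge0// => y _;
      exact: poweR_ge0.
  - by apply: emeasurable_funM => //; exact: (Lplus_integral2 l LFr).1.
  apply: filterS FF' => x -> _.
  have := hoelder_Lplus l (Lplus_pair1 x LF') mg g0 r0 q0 pq.
  have ge0 : 0 <= \int[l]_y (F' (x, y) * (g y)%:E).
    by apply: integral_ge0 => y _; rewrite mule_ge0 ?LF'.2 ?lee_fin.
  move=> /(le_poweR (ltW r0) ge0) /le_trans; apply.
  rewrite poweRM ?Lnorm_ge0// Lnorm_rpow ?gt_eqF//; last exact: Lplus_pair1.
  apply: lee_wpmul2l; first by apply: integral_ge0 => y _; exact: poweR_ge0.
  by rewrite mulrC poweRrM le_poweR ?Lnorm_ge0// ltW.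
rewrite ge0_integralZr ?poweR_ge0//; last 2 first.
  exact: (Lplus_integral2 l LFr).1.
  by move=> x _; apply: integral_ge0 => y _; exact: poweR_ge0.
rewrite (fubini_tonelli _ LFr.1 LFr.2).
rewrite -[X in _ <= A `^ X](subrK 1%R) poweRD; last first.
  by rewrite add_neq0_poweRD_def// subrK gt_eqF.
rewrite poweRe1// muleC rq lee_wpmul2l ?poweR_ge0//.
apply: le_integral_Lplus => //.
exact: (Lplus_integral2 m (Lplus_swap LFr)).
Qed.

(** Minkowski's inequality for [F ^ a] with exponent [b / a >= 1], followed by the [a]-th root.
    Moving the larger exponent inside can only increase the mixed norm. *)
Lemma Lnorm_swap_le {d1 d2 : measure_display} {X : measurableType d1}
  {Y : measurableType d2} {R : realType}
  (m : {sigma_finite_measure set X -> \bar R})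
  (l : {sigma_finite_measure set Y -> \bar R})
  (a b : R) (F : X * Y -> \bar R) :
  (0 < a)%R -> (a <= b)%R -> Lplus F ->
  'N[l]_(b%:E)[(fun y => 'N[m]_(a%:E)[(fun x => F (x, y))])] <=
  'N[m]_(a%:E)[(fun x => 'N[l]_(b%:E)[(fun y => F (x, y))])].
Proof.
move=> a0 ab LF; have b0 := lt_le_trans a0 ab.
have LG := Lplus_poweR a LF.
have ba : (1 <= b / a)%R by rewrite ler_pdivlMr// mul1r.
have LN := Lplus_Lnorm1 m a LF.
have LN' := Lplus_Lnorm2 l b LF.
rewrite (Lnorm_LplusE _ _ LN) (Lnorm_LplusE _ _ LN').
have E y : 'N[m]_(a%:E)[(fun x => F (x, y))] `^ b =
    (\int[m]_x (F (x, y) `^ a)) `^ (b / a).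
  by rewrite (Lnorm_LplusE _ _ (Lplus_pair2 y LF)) -poweRrM mulrC.
have E' x : 'N[l]_(b%:E)[(fun y => F (x, y))] `^ a =
    'N[l]_((b / a)%:E)[(fun y => F (x, y) `^ a)].
  rewrite (Lnorm_LplusE _ _ (Lplus_pair1 x LF)).
  rewrite (Lnorm_LplusE _ _ (Lplus_pair1 x LG)) -poweRrM invf_div mulrC.
  congr (_ `^ _).
  by apply: eq_integral => y _; rewrite -poweRrM mulrC divfK ?gt_eqF.
under eq_integral do rewrite E.
under [in leRHS]eq_integral do rewrite E'.
(* Splits the outer root into the root of the [b / a]-norm and a final [a]-th root common to both
   sides. *)
have -> : b^-1%R = ((b / a)^-1 * a^-1)%R.
  by rewrite invf_div mulrAC mulfV ?mul1r// gt_eqF.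
rewrite poweRrM; apply: le_poweR; first by rewrite ltW// invr_gt0.
  exact: poweR_ge0.
have LI := Lplus_integral2 m (Lplus_swap LG).
by have := Lnorm_integral_le l m ba (Lplus_swap LG); rewrite (Lnorm_LplusE _ _ LI).
Qed.

(** * Kernel operators acting on one variable of a product *)

Lemma Lplus_kernel_op2 {dX dT dY : measure_display} {X : measurableType dX}
  {T : measurableType dT} {Y : measurableType dY} {R : realType}
  (l : {sigma_finite_measure set T -> \bar R}) (k : X * T -> R)
  (h : T * Y -> \bar R) :
  measurable_fun [set: X * T] k -> (forall z, 0 <= k z)%R -> Lplus h ->
  Lplus (fun z : X * Y => kernel_op l k (fun t => h (t, z.2)) z.1).
Proof.
move=> mk k0 [mh h0].
(* With [y] as a parameter, the integrand is a function on [(X * Y) * T], and Tonelli gives joint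
   measurability in [(x, y)]. *)
apply: (Lplus_integral2 l
  (F := fun w : (X * Y) * T => (k (w.1.1, w.2))%:E * h (w.2, w.1.2))).
split=> [|w]; last by rewrite mule_ge0// lee_fin.
have m1 : measurable_fun [set: (X * Y) * T] (fun w => w.1.1).
  exact: (measurableT_comp measurable_fst measurable_fst).
have m2 : measurable_fun [set: (X * Y) * T] (fun w => w.1.2).
  exact: (measurableT_comp measurable_snd measurable_fst).
apply: emeasurable_funM.
  apply/measurable_EFinP; apply: (measurableT_comp mk).
  exact: measurable_fun_pair.
by apply: (measurableT_comp mh); exact: measurable_fun_pair.
Qed.

Section PartialOperator.
Context {dX dT dY : measure_display} {X : measurableType dX}
  {T : measurableType dT} {Y : measurableType dY} {R : realType}.
Variables (l : {sigma_finite_measure set T -> \bar R})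
  (m : {sigma_finite_measure set X -> \bar R})
  (n : {sigma_finite_measure set Y -> \bar R}).
Variables (p r s : R) (k : X * T -> R) (h : T * Y -> \bar R).
Hypotheses (p_gt0 : (0 < p)%R) (r_gt0 : (0 < r)%R)
  (mk : measurable_fun [set: X * T] k) (k_ge0 : forall z, (0 <= k z)%R)
  (Lh : Lplus h).

Let C := least_op_bound l m p r k.

Let C_in : op_bounds l m p r k C.
Proof. exact: least_op_bound_in. Qed.

Lemma Lnorm_kernel_op_inner : (0 < s)%R ->
  'N[n]_(s%:E)[(fun y => 'N[m]_(r%:E)[kernel_op l k (fun t => h (t, y))])] <=
  C * 'N[n]_(s%:E)[(fun y => 'N[l]_(p%:E)[(fun t => h (t, y))])].
Proof.
move=> s_gt0; have [C0 HC] := C_in; have LN := Lplus_Lnorm1 l p Lh.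
rewrite -Lnorm_LplusZ//; apply: le_Lnorm => //.
- exact: (Lplus_Lnorm1 m r (Lplus_kernel_op2 l mk k_ge0 Lh)).
- exact: LplusZ.
- by move=> y; apply: HC; exact: Lplus_pair2.
Qed.

(** As [k (x, t)] is constant in [y], Minkowski bounds the inner norm at [x] by the operator applied
    to the function of [t] given by the [s]-norm of [h (t, .)]. The bound [C] is used for that
    function. *)
Lemma Lnorm_kernel_op_outer : (1 <= s)%R ->
  'N[m]_(r%:E)[(fun x =>
     'N[n]_(s%:E)[(fun y => kernel_op l k (fun t => h (t, y)) x)])] <=
  C * 'N[l]_(p%:E)[(fun t => 'N[n]_(s%:E)[(fun y => h (t, y))])].
Proof.
move=> s1; have s0 : (0 < s)%R by rewrite (lt_le_trans ltr01).
have [C0 HC] := C_in.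
have LN := Lplus_Lnorm2 n s Lh; apply: (le_trans _ (HC _ LN)).
apply: le_Lnorm => //.
- exact: (Lplus_Lnorm2 n s (Lplus_kernel_op2 l mk k_ge0 Lh)).
- exact: Lplus_kernel_op.
move=> x.
have LkF : Lplus (fun z : Y * T => (k (x, z.2))%:E * h (z.2, z.1)).
  split=> [|z]; last by rewrite mule_ge0 ?(proj2 Lh)// lee_fin.
  apply: emeasurable_funM; last exact: (Lplus_swap Lh).1.
  apply/measurable_EFinP; apply: (measurableT_comp mk).
  exact: measurable_fun_pair.
apply: (le_trans (Lnorm_integral_le n l s1 LkF)).
rewrite [leRHS](_ : _ = \int[l]_t 'N[n]_(s%:E)[(fun y =>
    (k (x, t))%:E * h (t, y))])//.
apply: eq_integral => t _; rewrite Lnorm_LplusZ ?lee_fin//.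
exact: Lplus_pair1.
Qed.

End PartialOperator.

(** The exponent [p2 / p1] is the root of the inner norm followed by the power of the outer one. *)
Lemma mixed_normE {d1 d2 : measure_display} {T1 : measurableType d1}
  {T2 : measurableType d2} {R : realType} (m1 : {measure set T1 -> \bar R})
  (m2 : {measure set T2 -> \bar R}) (p1 p2 : R) (f : T1 * T2 -> \bar R) :
  mixed_norm m1 m2 p1 p2 f =
  'N[m2]_(p2%:E)[(fun t2 => 'N[m1]_(p1%:E)[(fun t1 => f (t1, t2))])].
Proof.
rewrite /mixed_norm unlock; congr (_ `^ _); apply: eq_integral => t2 _.
by rewrite gee0_abs ?poweR_ge0// -poweRrM mulrC.
Qed.

(** * The two factorizations of the product operator *)

Section ProductOperator.
Context {R : realType} {dT1 dT2 dX1 dX2 : measure_display}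
  {T1 : measurableType dT1} {T2 : measurableType dT2}
  {X1 : measurableType dX1} {X2 : measurableType dX2}.
Variables (l1 : {sigma_finite_measure set T1 -> \bar R})
  (l2 : {sigma_finite_measure set T2 -> \bar R})
  (k1 : X1 * T1 -> R) (k2 : X2 * T2 -> R) (f : T1 * T2 -> \bar R).
Hypotheses (mk1 : measurable_fun [set: X1 * T1] k1)
  (mk2 : measurable_fun [set: X2 * T2] k2)
  (k1_ge0 : forall z, (0 <= k1 z)%R) (k2_ge0 : forall z, (0 <= k2 z)%R)
  (Lf : Lplus f).

Let Lkkf x1 x2 : Lplus (fun t : T1 * T2 =>
  (k1 (x1, t.1))%:E * (k2 (x2, t.2))%:E * f t).
Proof.
split=> [|t]; last by rewrite !mule_ge0 ?(proj2 Lf)// lee_fin.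
apply: emeasurable_funM; last exact: Lf.1.
apply: emeasurable_funM; apply/measurable_EFinP.
  by apply: (measurableT_comp mk1); exact: measurable_fun_pair.
by apply: (measurableT_comp mk2); exact: measurable_fun_pair.
Qed.

(** Tonelli with [t1] innermost; the factor [k2] does not depend on [t1] and leaves the inner
    integral. *)
Lemma product_op_kernel21 x1 x2 : product_op l1 l2 k1 k2 f (x1, x2) =
  kernel_op l2 k2 (fun t2 => kernel_op l1 k1 (fun t1 => f (t1, t2)) x1) x2.
Proof.
have [mF F0] := Lkkf x1 x2.
rewrite /product_op fubini_tonelli2//; apply: eq_integral => t2 _.
rewrite /fubini_G /kernel_op -ge0_integralZl ?lee_fin//=.
- by apply: eq_integral => t1 _; rewrite /= muleA (muleC (k2 _)%:E).
- apply: emeasurable_funM; last exact: (Lplus_pair2 t2 Lf).1.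
  by apply/measurable_EFinP; exact: (measurableT_comp mk1).
- by move=> t1 _; rewrite mule_ge0 ?(proj2 Lf)// lee_fin.
Qed.

Lemma product_op_kernel12 x1 x2 : product_op l1 l2 k1 k2 f (x1, x2) =
  kernel_op l1 k1 (fun t1 => kernel_op l2 k2 (fun t2 => f (t1, t2)) x2) x1.
Proof.
have [mF F0] := Lkkf x1 x2.
rewrite /product_op fubini_tonelli1//; apply: eq_integral => t1 _.
rewrite /fubini_F /kernel_op -ge0_integralZl ?lee_fin//=.
- by apply: eq_integral => t2 _; rewrite /= muleA.
- apply: emeasurable_funM; last exact: (Lplus_pair1 t1 Lf).1.
  by apply/measurable_EFinP; exact: (measurableT_comp mk2).
- by move=> t2 _; rewrite mule_ge0 ?(proj2 Lf)// lee_fin.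
Qed.

(** Needed to exchange the norms of the image itself; the iterated form supplies the
    measurability. *)
Lemma Lplus_product_op : Lplus (product_op l1 l2 k1 k2 f).
Proof.
have L1 := Lplus_kernel_op2 l1 mk1 k1_ge0 Lf.
have L2 := Lplus_kernel_op2 l2 mk2 k2_ge0 (Lplus_swap L1).
have := Lplus_swap L2; congr Lplus; apply/funext => -[x1 x2].
by rewrite product_op_kernel21.
Qed.

End ProductOperator.

(** * Mixed-norm bounds for the product operator *)

Theorem theorem2p1 (R : realType)
  (dT1 dT2 dX1 dX2 : measure_display)
  (T1 : measurableType dT1) (T2 : measurableType dT2)
  (X1 : measurableType dX1) (X2 : measurableType dX2)
  (l1 : {sigma_finite_measure set T1 -> \bar R})
  (l2 : {sigma_finite_measure set T2 -> \bar R})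
  (m1 : {sigma_finite_measure set X1 -> \bar R})
  (m2 : {sigma_finite_measure set X2 -> \bar R})
  (p1 p2 r1 r2 : R)
  (p1_gt0 : (0 < p1)%R) (p2_gt0 : (0 < p2)%R)
  (r1_gt0 : (0 < r1)%R) (r2_gt0 : (0 < r2)%R)
  (k1 : X1 * T1 -> R) (k2 : X2 * T2 -> R)
  (mk1 : measurable_fun [set: X1 * T1] k1)
  (mk2 : measurable_fun [set: X2 * T2] k2)
  (k1_ge0 : forall z, (0 <= k1 z)%R) (k2_ge0 : forall z, (0 <= k2 z)%R) :
  let C1 := least_op_bound l1 m1 p1 r1 k1 in
  let C2 := least_op_bound l2 m2 p2 r2 k2 in
  let K := product_op l1 l2 k1 k2 in
  ((1 <= r1)%R ->
     forall f : T1 * T2 -> \bar R, Lplus f ->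
       mixed_norm m1 m2 r1 r2 (K f) <= C1 * C2 * mixed_norm l1 l2 p1 p2 f) /\
  ((1 <= r1)%R -> (1 <= r2)%R -> (Num.min p1 r1 <= Num.max p2 r2)%R ->
     forall f : T1 * T2 -> \bar R, Lplus f ->
       mixed_norm m1 m2 r1 r2 (K f)
         <= C1 * C2 * mixed_norm l2 l1 p2 p1 (fun z => f (z.2, z.1))).
Proof.
move=> C1 C2 K.
have C1_ge0 : 0 <= C1.
  exact: (least_op_bound_in l1 m1 p1_gt0 r1_gt0 mk1 k1_ge0).1.
have C2_ge0 : 0 <= C2.
  exact: (least_op_bound_in l2 m2 p2_gt0 r2_gt0 mk2 k2_ge0).1.
have partA f : (1 <= r1)%R -> Lplus f ->
    mixed_norm m1 m2 r1 r2 (K f) <= C1 * C2 * mixed_norm l1 l2 p1 p2 f.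
  move=> r1_ge1 Lf; rewrite !mixed_normE.
  (* [K1 f] as a function of [(t2, x1)], since the variable acted on by the next operator must come
     first. *)
  have Lg := Lplus_swap (Lplus_kernel_op2 l1 mk1 k1_ge0 Lf).
  rewrite [leLHS](_ : _ = 'N[m2]_(r2%:E)[(fun x2 => 'N[m1]_(r1%:E)[(fun x1 =>
    kernel_op l2 k2 (fun t2 => kernel_op l1 k1 (fun t1 => f (t1, t2)) x1) x2)])]).
    apply: (le_trans
      (Lnorm_kernel_op_outer l2 m2 m1 p2_gt0 r2_gt0 mk2 k2_ge0 Lg r1_ge1)).
    rewrite (muleC C1) -muleA lee_wpmul2l//.
    exact: (Lnorm_kernel_op_inner l1 m1 l2 p1_gt0 r1_gt0 mk1 k1_ge0 Lf p2_gt0).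
  by do 2 (apply: eq_Lnorm => ? /=); exact: product_op_kernel21.
split=> [r1_ge1 f Lf|r1_ge1 r2_ge1 minmax f Lf]; first exact: partA.
rewrite [X in _ * X]mixed_normE/=.
have : [\/ (p1 <= p2)%R, (r1 <= r2)%R, (p1 <= r2)%R | (r1 <= p2)%R].
  move: minmax; rewrite le_max !ge_min => /orP[/orP[]|/orP[]] h.
  - by constructor 1.
  - by constructor 4.
  - by constructor 3.
  - by constructor 2.
have LKf := Lplus_product_op l1 l2 mk1 mk2 k1_ge0 k2_ge0 Lf.
have LK1 := Lplus_swap (Lplus_kernel_op2 l1 mk1 k1_ge0 Lf).
have LK2 := Lplus_swap (Lplus_kernel_op2 l2 mk2 k2_ge0 (Lplus_swap Lf)).
case=> [p12|r12|p1r2|r1p2].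
(* Exchange before both operators, on [f], with [p1 <= p2]. *)
- apply: (le_trans (partA f r1_ge1 Lf)).
  rewrite mixed_normE lee_wpmul2l ?mule_ge0//.
  exact: Lnorm_swap_le.
(* Exchange after both operators; then [K1] is moved past the [r2]-norm, where [r2 >= 1] serves
   Minkowski. *)
- rewrite mixed_normE; apply: (le_trans (Lnorm_swap_le m1 m2 r1_gt0 r12 LKf)).
  rewrite [leLHS](_ : _ = 'N[m1]_(r1%:E)[(fun x1 => 'N[m2]_(r2%:E)[(fun x2 =>
    kernel_op l1 k1 (fun t1 => kernel_op l2 k2 (fun t2 => f (t1, t2)) x2) x1)])]).
    apply: (le_trans
      (Lnorm_kernel_op_outer l1 m1 m2 p1_gt0 r1_gt0 mk1 k1_ge0 LK2 r2_ge1)).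
    rewrite -muleA lee_wpmul2l//.
    exact: (Lnorm_kernel_op_inner l2 m2 l1 p2_gt0 r2_gt0 mk2 k2_ge0
      (Lplus_swap Lf) p1_gt0).
  by do 2 (apply: eq_Lnorm => ? /=); exact: product_op_kernel12.
(* Exchange between the operators, on [K2 f], with exponents [p1 <= r2]; both bounds are then used
   in the inner norm. *)
- rewrite mixed_normE.
  rewrite [leLHS](_ : _ = 'N[m2]_(r2%:E)[(fun x2 => 'N[m1]_(r1%:E)[(fun x1 =>
    kernel_op l1 k1 (fun t1 => kernel_op l2 k2 (fun t2 => f (t1, t2)) x2) x1)])]).
    apply: (le_trans
      (Lnorm_kernel_op_inner l1 m1 m2 p1_gt0 r1_gt0 mk1 k1_ge0 LK2 r2_gt0)).
    rewrite -muleA lee_wpmul2l//.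
    apply: (le_trans (Lnorm_swap_le l1 m2 p1_gt0 p1r2 LK2)).
    exact: (Lnorm_kernel_op_inner l2 m2 l1 p2_gt0 r2_gt0 mk2 k2_ge0
      (Lplus_swap Lf) p1_gt0).
  by do 2 (apply: eq_Lnorm => ? /=); exact: product_op_kernel12.
(* Exchange between the operators, on [K1 f], with exponents [r1 <= p2]. Minkowski serves twice, for
   [r1 >= 1] and for [p2 >= r1 >= 1]. *)
- rewrite mixed_normE.
  have p2_ge1 := le_trans r1_ge1 r1p2.
  rewrite [leLHS](_ : _ = 'N[m2]_(r2%:E)[(fun x2 => 'N[m1]_(r1%:E)[(fun x1 =>
    kernel_op l2 k2 (fun t2 => kernel_op l1 k1 (fun t1 => f (t1, t2)) x1) x2)])]).
    apply: (le_trans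
      (Lnorm_kernel_op_outer l2 m2 m1 p2_gt0 r2_gt0 mk2 k2_ge0 LK1 r1_ge1)).
    rewrite (muleC C1) -muleA lee_wpmul2l//.
    apply: (le_trans (Lnorm_swap_le m1 l2 r1_gt0 r1p2 (Lplus_swap LK1))).
    exact: (Lnorm_kernel_op_outer l1 m1 l2 p1_gt0 r1_gt0 mk1 k1_ge0 Lf p2_ge1).
  by do 2 (apply: eq_Lnorm => ? /=); exact: product_op_kernel21.
Qed.
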